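(* Let $D\subseteq\mathbb{C}$ and let $g: D\to\mathbb{C}$ be a function. For $z\in\mathbb{C}$ define $V^g_z: D\to\mathbb{C}$ by $V^g_z(s)=g(s)e^{zs}$, and let $\Phi^g_z=\{s\in D : V^g_z(s)=s\}$ be its set of fixed points. Let $u$ be a complex number with $|u|=1$, and let $X=(x_0,x_1,x_2,\dots)$ be an infinite increasing arithmetic progression of real numbers with $x_0=0$. Let $\vec{\phi}=(\phi_0,\phi_1,\phi_2,\dots)$ be a sequence with $\phi_n\in\Phi^g_{x_n u}$ for every $n\ge 0$ (i.e. $\vec\phi\in\Phi^g_{0}\times\Phi^g_{x_1u}\times\Phi^g_{x_2u}\times\cdots$). Suppose that $\vec{\phi}$ converges to a complex number $\lambda\in D$, that $g$ is continuous at $\lambda$, and that $\Re(\lambda)\Re(u)-\Im(\lambda)\Im(u)>0$. Then $g(\lambda)=0$. *)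

(* Defs.v *)
From Stdlib Require Export Reals.
From Coquelicot Require Export Coquelicot.

Open Scope R_scope.

(* Coquelicot has no complex exponential: e^(a + bi) = e^a (cos b + i sin b). *)
Definition Cexp (z : C) : C :=
  (exp (Re z) * cos (Im z), exp (Re z) * sin (Im z)).

Definition V (g : C -> C) (z s : C) : C := (g s * Cexp (z * s))%C.

(* A function D -> C is represented by a total g : C -> C together with
   D : C -> Prop; the values of g outside D play no role. *)
Definition Phi (D : C -> Prop) (g : C -> C) (z : C) : C -> Prop :=
  fun s => D s /\ V g z s = s.

Definition arithmetic_progression (x : nat -> R) : Prop :=
  exists d : R, forall n : nat, x (S n) = x n + d.

Definition increasing_seq (x : nat -> R) : Prop :=
  forall n : nat, x n < x (S n).

(* The pointwise version of Coquelicot's continuous_on. *)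
Definition continuous_within (D : C -> Prop) (g : C -> C) (a : C) : Prop :=
  filterlim g (within D (locally a)) (locally (g a)).

(* Main.v *)
From Stdlib Require Import Lra.
Require Import Defs.

(** Taking moduli in [V g (x_n u) phi_n = phi_n] gives
    [|g (phi_n)| = |phi_n| exp (- x_n Re (u phi_n))].  The exponent tends to
    [-oo], since [Re (u phi_n)] tends to [Re (u lambda) > 0] and [x_n] to
    [+oo]; as [|phi_n|] converges, the right-hand side tends to [0], while the
    left-hand side tends to [|g lambda|]. *)

Lemma Cmod_Cexp (z : C) : Cmod (Cexp z) = exp (Re z).
Proof.
  unfold Cmod, Cexp; simpl fst; simpl snd.
  replace (_ + _) with (exp (Re z) * exp (Re z)).
  - apply sqrt_square, Rlt_le, exp_pos.
  - rewrite <- (Rmult_1_r (exp (Re z) * exp (Re z))), <- (sin2_cos2 (Im z)).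
    unfold Rsqr; ring.
Qed.

Lemma filterlim_Cmod (z : C) : filterlim Cmod (locally z) (locally (Cmod z)).
Proof.
  exact (filterlim_norm (K := C_AbsRing) (V := C_NormedModule) z).
Qed.

Lemma filterlim_Re (z : C) : filterlim Re (locally z) (locally (Re z)).
Proof.
  destruct z as [a b].
  exact (continuous_fst (U := R_UniformSpace) (V := R_UniformSpace) a b).
Qed.

Lemma filterlim_Im (z : C) : filterlim Im (locally z) (locally (Im z)).
Proof.
  destruct z as [a b].
  exact (continuous_snd (U := R_UniformSpace) (V := R_UniformSpace) a b).
Qed.

Lemma is_lim_seq_Re_mult (u : C) (phi : nat -> C) (l : C) :
  filterlim phi eventually (locally l) ->
  is_lim_seq (fun n => Re (u * phi n)%C) (Re (u * l)%C).
Proof.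
  intros h.
  (* [Re (u * z)] is convertible to [Re u * Re z - Im u * Im z], so the limit can be taken one real
     coordinate at a time. *)
  apply (is_lim_seq_minus' (fun n => Re u * Re (phi n)) (fun n => Im u * Im (phi n))).
  - apply (is_lim_seq_scal_l (fun n => Re (phi n)) (Re u) (Re l)).
    exact (filterlim_comp _ _ _ _ _ _ _ _ h (filterlim_Re l)).
  - apply (is_lim_seq_scal_l (fun n => Im (phi n)) (Im u) (Im l)).
    exact (filterlim_comp _ _ _ _ _ _ _ _ h (filterlim_Im l)).
Qed.

Lemma is_lim_seq_arithmetic_progression (x : nat -> R) :
  arithmetic_progression x -> increasing_seq x -> is_lim_seq x p_infty.
Proof.
  intros [d hd] hincr.
  assert (d_pos : 0 < d) by (specialize (hincr 0%nat); rewrite hd in hincr; lra).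
  (* Closed form of the progression; the first increment has already forced [d > 0], so the linear
     term diverges. *)
  apply is_lim_seq_ext with (fun n => x 0%nat + INR n * d).
  - induction n as [|n IHn]; [simpl; ring|].
    rewrite hd, <- IHn, S_INR; ring.
  - apply is_lim_seq_plus with (x 0%nat) p_infty;
      [apply is_lim_seq_const| |reflexivity].
    eapply is_lim_seq_mult; [apply is_lim_seq_INR|apply is_lim_seq_const|].
    apply is_Rbar_mult_p_infty_pos; exact d_pos.
Qed.

(** Continuity relative to [D] suffices because the whole sequence stays in [D], so it converges to
    [l] along [within D (locally l)] too. *)
Lemma is_lim_seq_Cmod_within (D : C -> Prop) (g : C -> C) (phi : nat -> C) (l : C) :
  (forall n, D (phi n)) -> filterlim phi eventually (locally l) ->
  continuous_within D g l ->
  is_lim_seq (fun n => Cmod (g (phi n))) (Cmod (g l)).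
Proof.
  intros hD hphi hg.
  refine (filterlim_comp _ _ _ (fun n => g (phi n)) Cmod _ _ _ _ (filterlim_Cmod _)).
  refine (filterlim_comp _ _ _ phi g _ _ _ _ hg).
  intros P hP; unfold filtermap.
  apply (filter_imp (fun n => D (phi n) -> P (phi n))).
  - intros n hn; exact (hn (hD n)).
  - exact (hphi _ hP).
Qed.

Lemma Cmod_fixed_point (g : C -> C) (r : R) (u s : C) :
  V g (RtoC r * u)%C s = s ->
  Cmod (g s) = Cmod s * exp (- (r * Re (u * s)%C)).
Proof.
  (* Only the [s] under [Cmod] is expanded into [V g _ s]; its factor [exp (r * Re (u * s))] then
     cancels the exponential on the right. *)
  intros h; rewrite <- h at 2; unfold V.
  rewrite Cmod_mult, Cmod_Cexp, Rmult_assoc, <- exp_plus.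
  replace (Re (RtoC r * u * s)%C) with (r * Re (u * s)%C) by (simpl; ring).
  rewrite Rplus_opp_r, exp_0; ring.
Qed.

Theorem theorem1 (D : C -> Prop) (g : C -> C) (u : C) (x : nat -> R)
    (phi : nat -> C) (lambda : C)
    (hu : Cmod u = 1)
    (hx_arith : arithmetic_progression x)
    (hx_incr : increasing_seq x)
    (hx0 : x 0%nat = 0)
    (hphi : forall n : nat, Phi D g (RtoC (x n) * u)%C (phi n))
    (hlim : filterlim phi eventually (locally lambda))
    (hlambda : D lambda)
    (hg : continuous_within D g lambda)
    (hpos : Re lambda * Re u - Im lambda * Im u > 0) :
  g lambda = RtoC 0.
Proof.
  assert (hexponent : is_lim_seq (fun n => - (x n * Re (u * phi n)%C)) m_infty).
  { apply (is_lim_seq_opp _ p_infty).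
    eapply is_lim_seq_mult.
    - apply is_lim_seq_arithmetic_progression; assumption.
    - apply is_lim_seq_Re_mult; exact hlim.
    (* The limit [Re (u * lambda)] is, up to commutativity, the quantity that [hpos] makes
       positive. *)
    - apply is_Rbar_mult_p_infty_pos.
      unfold Re, Im in *; simpl; lra. }
  assert (hzero : is_lim_seq (fun n => Cmod (g (phi n))) 0).
  { apply is_lim_seq_ext
      with (fun n => Cmod (phi n) * exp (- (x n * Re (u * phi n)%C))).
    - intros n; symmetry; apply Cmod_fixed_point, hphi.
    (* Writing the limit as [Cmod lambda * 0] makes it a product of two finite limits. *)
    - rewrite <- (Rmult_0_r (Cmod lambda)).
      apply is_lim_seq_mult'.
      + exact (filterlim_comp _ _ _ _ _ _ _ _ hlim (filterlim_Cmod lambda)).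
      + apply (filterlim_comp _ _ _ _ _ _ _ _ hexponent).
        apply is_lim_exp_m. }
  assert (hglambda := is_lim_seq_Cmod_within D g phi lambda
                        (fun n => proj1 (hphi n)) hlim hg).
  apply Cmod_eq_0.
  apply is_lim_seq_unique in hzero, hglambda.
  congruence.
Qed.
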